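(* Let $(S,\cdot)$ be a semigroup and $\mathcal A\subseteq\mathcal P(S)$. The following are equivalent: (1) $\mathcal A$ is collectionwise piecewise syndetic. (2) For any hyperfinite approximation $H$ of $S$, there is $\alpha\in S^*$ such that for every finite $\mathcal F\subseteq\mathcal A$, $H\cdot\alpha\subseteq S^{-1}\left(\bigcap\mathcal F\right)^*$. (3) For any hyperfinite approximation $H$ of $S$, there are $\alpha\in S^*$ and a function $G:\mathcal P_f(\mathcal A)\to\mathcal P_f(S)$ such that for every finite $\mathcal F\subseteq\mathcal A$, $H\cdot\alpha\subseteq G(\mathcal F)^{-1}\left(\bigcap\mathcal F\right)^*$. (4) There are a hyperfinite approximation $H$ of $S$, $\alpha\in S^*$ and a function $G:\mathcal P_f(\mathcal A)\to\mathcal P_f(S)$ such that for every finite $\mathcal F\subseteq\mathcal A$, $H\cdot\alpha\subseteq G(\mathcal F)^{-1}\left(\bigcap\mathcal F\right)^*$. (5) There are $\alpha\in S^*$ and a function $G:\mathcal P_f(\mathcal A)\to\mathcal P_f(S)$ such that for every finite $\mathcal F\subseteq\mathcal A$, $S\cdot\alpha\subseteq G(\mathcal F)^{-1}\left(\bigcap\mathcal F\right)^*$.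
   Context: Work in a sufficiently saturated nonstandard extension; $S^*$ is the nonstandard extension of $S$ and $B^*$ that of $B\subseteq S$. A hyperfinite approximation of a set $X$ is a hyperfinite set $H$ with $X\subseteq H\subseteq X^*$. $\mathcal P_f(X)$ is the set of finite subsets of $X$; $\bigcap\emptyset=S$. For $G\subseteq S$ and $B\subseteq S$, $G^{-1}B^*=\{\xi\in S^*:g\xi\in B^*\text{ for some }g\in G\}$, and $G^{-1}B$ is defined analogously within $S$. $\mathcal A$ is collectionwise piecewise syndetic if there are functions $G:\mathcal P_f(\mathcal A)\to\mathcal P_f(S)$ and $\chi:\mathcal P_f(\mathcal A)\times\mathcal P_f(S)\to S$ such that for all $F\in\mathcal P_f(S)$ and all $\mathcal F,\mathcal H\in\mathcal P_f(\mathcal A)$ with $\mathcal F\subseteq\mathcal H$, $F\cdot\chi(\mathcal H,F)\subseteq G(\mathcal F)^{-1}\left(\bigcap\mathcal F\right)$. *)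

(* Defs.v *)
From mathcomp Require Import all_boot.
From mathcomp Require Import boolp classical_sets cardinality.

Set Implicit Arguments.
Unset Strict Implicit.
Unset Printing Implicit Defensive.

Local Open Scope classical_set_scope.

(* Nonstandard extensions are elementary extensions of the full many-sorted   *)
(* structure whose sorts are all types, with a symbol for every finitary      *)
(* function and every finitary relation.  Since [set X] is itself a sort,     *)
(* formulas with bounded quantifiers over subsets, sets of subsets, etc. are  *)
(* first-order formulas of this language.                                     *)

(* [env V [:: X1; ...; Xn]] is V X1 * (... * (V Xn * unit)). *)
Fixpoint env (V : Type -> Type) (Gamma : seq Type) : Type :=
  if Gamma is X :: Gamma' then (V X * env V Gamma')%type else unit.

Fixpoint env_map (V W : Type -> Type) (f : forall X, V X -> W X)
    (Gamma : seq Type) : env V Gamma -> env W Gamma :=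
  if Gamma is X :: Gamma' then
    fun e : env V (X :: Gamma') => (f X e.1, env_map f e.2)
  else fun=> tt.

Definition standard (Gamma : seq Type) := env (fun X => X) Gamma.

(* De Bruijn variables of sort X in a context. *)
Inductive var : seq Type -> Type -> Type :=
| VZ Gamma X : var (X :: Gamma) X
| VS Gamma X Y : var Gamma X -> var (Y :: Gamma) X.

Fixpoint lookup (V : Type -> Type) Gamma X (v : var Gamma X) :
    env V Gamma -> V X :=
  match v in var Gamma' X' return env V Gamma' -> V X' with
  | VZ _ _ => fun e => e.1
  | VS _ _ _ v' => fun e => lookup v' e.2
  end.

(* The atomic formulas are R(x1, ..., xn) and f(x1, ..., xn) = y; nested      *)
(* terms are expressed by means of auxiliary quantified variables.            *)
Inductive formula : seq Type -> Type :=
| FRel Gamma Delta (R : standard Delta -> Prop) (x : env (var Gamma) Delta) :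
    formula Gamma
| FFun Gamma Delta Y (f : standard Delta -> Y) (x : env (var Gamma) Delta)
    (y : var Gamma Y) : formula Gamma
| FNot Gamma : formula Gamma -> formula Gamma
| FAnd Gamma : formula Gamma -> formula Gamma -> formula Gamma
| FForall Gamma X : formula (X :: Gamma) -> formula Gamma.

Record interpretation := Interpretation {
  dom :> Type -> Type;
  fun_ext : forall Delta Y, (standard Delta -> Y) -> env dom Delta -> dom Y;
  rel_ext : forall Delta, (standard Delta -> Prop) -> env dom Delta -> Prop }.

Definition standard_interpretation : interpretation :=
  @Interpretation (fun X => X) (fun _ _ f => f) (fun _ R => R).

Fixpoint sat (M : interpretation) Gamma (phi : formula Gamma) :
    env M Gamma -> Prop :=
  match phi in formula Gamma' return env M Gamma' -> Prop with
  | FRel _ _ R x => fun e => rel_ext R (env_map (fun _ v => lookup v e) x)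
  | FFun _ _ _ f x y => fun e =>
      fun_ext f (env_map (fun _ v => lookup v e) x) = lookup y e
  | FNot _ psi => fun e => ~ sat psi e
  | FAnd _ psi1 psi2 => fun e => sat psi1 e /\ sat psi2 e
  | FForall _ X psi => fun e => forall a : M X, @sat M (X :: _) psi (a, e)
  end.

Record nonstandard_extension := NonstandardExtension {
  star :> interpretation;
  std : forall X : Type, X -> star X;
  transfer : forall Gamma (phi : formula Gamma) (e : standard Gamma),
    @sat standard_interpretation _ phi e <-> sat phi (env_map std e) }.

Arguments std _ {X} _.

Record Pfin (T : Type) (X : set T) := MkPfin {
  Pfin_set :> set T;
  Pfin_finite : finite_set Pfin_set;
  Pfin_sub : Pfin_set `<=` X }.

Section Nonstandard.
Variable E : nonstandard_extension.

Definition starset (T : Type) (B : set T) : set (E T) :=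
  [set xi | @rel_ext E [:: T] (fun e => B e.1) (xi, tt)].

(* The set of all x such that x belongs (in the sense of E) to b. *)
Definition internal_set (T : Type) (b : E (set T)) : set (E T) :=
  [set xi | @rel_ext E [:: T; set T] (fun e => e.2.1 e.1) (xi, (b, tt))].

Definition hyperfinite (T : Type) (H : set (E T)) : Prop :=
  exists h : E (Pfin [set: T]),
    H = [set xi | @rel_ext E [:: T; Pfin [set: T]]
                    (fun e => (e.2.1 : set T) e.1) (xi, (h, tt))].

Definition hyperfinite_approximation (T : Type) (X : set T) (H : set (E T)) :
    Prop :=
  [/\ hyperfinite H, std E @` X `<=` H & H `<=` starset X].

(* |K|^+-saturation.  The family b need not be injective, so this covers all  *)
(* nonempty families of at most |K| internal sets.                            *)
Definition saturated (K : Type) : Prop :=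
  forall (T : Type) (b : K -> E (set T)),
    (forall J : set K, finite_set J ->
       \bigcap_(k in J) internal_set (b k) !=set0) ->
    \bigcap_(k in [set: K]) internal_set (b k) !=set0.

End Nonstandard.

Arguments starset E {T} B _.
Arguments saturated E K : clear implicits.

Section Syndetic.
Variable S : semigroupType.

(* G^-1 B, which does not require inverses. *)
Definition inv_translate (G B : set S) : set S :=
  [set x | exists2 g, G g & B (g * x)%g].

Definition collectionwise_piecewise_syndetic (A : set (set S)) : Prop :=
  exists (G : Pfin A -> Pfin [set: S])
         (chi : Pfin A -> Pfin [set: S] -> S),
    forall (F : Pfin [set: S]) (FF HH : Pfin A), FF `<=` HH ->
      [set (x * chi HH F)%g | x in F] `<=`
        inv_translate (G FF) (\bigcap_(B in FF) B).

Variable E : nonstandard_extension.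

Definition starmul (xi eta : E S) : E S :=
  @fun_ext E [:: S : Type; S : Type] S (fun e => (e.1 * e.2.1)%g) (xi, (eta, tt)).

(* H . alpha *)
Definition rtranslate (H : set (E S)) (alpha : E S) : set (E S) :=
  [set starmul xi alpha | xi in H].

(* G^-1 B^* *)
Definition star_inv_translate (G B : set S) : set (E S) :=
  [set xi | exists2 g, G g & starset E B (starmul (std E g) xi)].

End Syndetic.

Arguments star_inv_translate {S} E G B _.

(* Main.v *)
(** Let [H] be a hyperfinite approximation of [S].  By saturation there is a
    hyperfinite [HH] containing the standard elements of [A]; every standard
    finite subset of [A] is then contained in [HH], so transferring the
    condition on [(G, chi)] shows that [alpha := chi^*(HH, H)] is as required
    in (2).  A second use of saturation, over [g : S], replaces [S] by a finite
    [G F].  Conversely, given (5) and standard finite [F] and [HH], a finite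
    intersection of sets [B] with [alpha] in [B^*] is nonempty by transfer, and
    any of its elements can serve as [chi(HH, F)].

    All instances of transfer are reduced to one principle: if [R] is defined
    by the formula [phi] in the standard structure, then the extension of [R]
    is defined by [phi] in [E] (lemma [rel_ext_definable]). *)
Require Import Defs.
From mathcomp Require Import all_boot.
From mathcomp Require Import boolp classical_sets cardinality.

Set Implicit Arguments.
Unset Strict Implicit.

Local Open Scope classical_set_scope.

(** * Finite sets *)

Lemma finite_set_induction (T : Type) (P : set T -> Prop) :
  P set0 -> (forall x A, finite_set A -> P A -> P (x |` A)) ->
  forall A, finite_set A -> P A.
Proof.
(* [classic T] equips an arbitrary type with the decidable equality that enumeration by a sequence
   requires. *)
move=> P0 PU A /(@finite_seqP {classic T})[s ->].
elim: s => [|x s IHs]; first by rewrite set_nil.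
have -> : [set` x :: s] = x |` [set` s].
  apply/seteqP; split=> y /=; first by rewrite inE => /orP[/eqP|]; [left|right].
  by rewrite inE => -[->|->]; rewrite ?eqxx ?orbT.
by apply: PU => //; exact: (@finite_seq {classic T}).
Qed.

Lemma finite_powerset (T : Type) (A : set T) :
  finite_set A -> finite_set [set B | B `<=` A].
Proof.
elim/finite_set_induction => [|x {}A _ IHA].
  apply: (sub_finite_set _ (finite_set1 set0)) => B /=.
  by rewrite subset0 => ->.
apply: (@sub_finite_set _ _
  ([set B | B `<=` A] `|` (setU [set x]) @` [set B | B `<=` A])); last first.
  by rewrite finite_setU; split=> //; exact: finite_image.
move=> B /= BxA; have [Bx|Bx] := pselect (B x).
  right; exists (B `\ x); last exact: setD1K.
  by move=> y [/BxA[->|] //] /(_ erefl).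
by left=> y By; have [yx|//] := BxA y By; case: Bx; rewrite -yx.
Qed.

Lemma Pfin_ext (T : Type) (X : set T) (F F' : Pfin X) :
  F = F' :> set T -> F = F'.
Proof.
case: F F' => [F fF FX] [F' fF' F'X] /= FF'; subst F'.
by congr MkPfin; exact: Prop_irrelevance.
Qed.

Lemma finite_Pfin_subsets (T : Type) (X A : set T) :
  finite_set A -> finite_set [set F : Pfin X | F `<=` A].
Proof.
move=> /finite_powerset fA; apply: (finite_preimage _ fA).
by move=> F F' _ _ /Pfin_ext.
Qed.

(** Intersecting with [X] lets the finite index sets coming from saturation, which need not lie in
    [X], serve as elements of [Pfin X]. *)
Definition Pfin_cover (T : Type) (X A : set T) (fA : finite_set A) : Pfin X :=
  MkPfin (finite_setIr X fA) (@subIsetl _ X A).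

(** * Transfer of definable relations *)

Lemma env_map_comp (U V W : Type -> Type) (f : forall X, V X -> W X)
    (g : forall X, U X -> V X) Gamma (x : env U Gamma) :
  env_map f (env_map g x) = env_map (fun X u => f X (g X u)) x.
Proof. by elim: Gamma x => //= X Gamma IH [a x] /=; rewrite IH. Qed.

Definition subst (V : Type -> Type) Gamma Delta (e : env V Gamma)
    (x : env (var Gamma) Delta) : env V Delta :=
  env_map (fun X v => lookup v e) x.

Definition weaken Y Gamma Delta (x : env (var Gamma) Delta) :
    env (var (Y :: Gamma)) Delta :=
  env_map (fun X v => VS Y v) x.

Lemma subst_weaken (V : Type -> Type) Y Gamma Delta (a : V Y)
    (e : env V Gamma) (x : env (var Gamma) Delta) :
  @subst V (Y :: Gamma) Delta (a, e) (weaken Y x) = subst e x.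
Proof. by rewrite /subst /weaken env_map_comp. Qed.

Fixpoint vars Gamma : env (var Gamma) Gamma :=
  if Gamma is X :: Gamma' then (VZ Gamma' X, weaken X (vars Gamma')) else tt.

Lemma subst_vars (V : Type -> Type) Gamma (e : env V Gamma) :
  subst e (vars Gamma) = e.
Proof.
elim: Gamma e => [[]//|X Gamma IH [a e]].
by rewrite /subst /=; congr pair; rewrite -[RHS]IH -(subst_weaken a).
Qed.

Definition FImp Gamma (phi psi : formula Gamma) := FNot (FAnd phi (FNot psi)).

Lemma sat_imp (M : interpretation) Gamma (phi psi : formula Gamma)
    (e : env M Gamma) : sat (FImp phi psi) e <-> (sat phi e -> sat psi e).
Proof.
by split=> [/= /not_andP[//|/contrapT]|/= h [/h]] //.
Qed.

Section Extension.
Variable E : nonstandard_extension.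

(** [transfer] allows standard parameters only. Universal quantification over the context gives a
    closed formula, whose truth in [E] covers all parameters. *)
Lemma transfer_valid Gamma (phi : formula Gamma) :
  (forall e, @sat standard_interpretation _ phi e) ->
  forall e : env E Gamma, sat phi e.
Proof.
elim: Gamma phi => [|X Gamma IH] phi valid_phi e.
  by case: e; apply/(transfer E phi tt).
by case: e => a e; apply: (IH (FForall phi)) => {}e b; exact: valid_phi.
Qed.

(** Each implication between the symbol [R] and [phi] is a formula valid in the standard structure,
    hence valid in [E]. *)
Lemma rel_ext_definable Gamma (R : standard Gamma -> Prop)
    (phi : formula Gamma) :
  (forall e, R e <-> @sat standard_interpretation _ phi e) ->
  forall e : env E Gamma, rel_ext R e <-> sat phi e.
Proof.
move=> Rphi e.
have defR (M : interpretation) (d : env M Gamma) :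
    sat (FRel R (vars Gamma)) d = rel_ext R d.
  by rewrite /= -/(subst d (vars Gamma)) subst_vars.
split.
  rewrite -defR; apply/sat_imp/transfer_valid => d.
  by apply/sat_imp; rewrite defR => /Rphi.
rewrite -[X in _ -> X]defR; apply/sat_imp/transfer_valid => d.
by apply/sat_imp; rewrite defR => /Rphi.
Qed.

(** Relations differing by a permutation, repetition or omission of arguments are distinct symbols;
    this links their extensions. *)
Lemma rel_ext_subst Gamma Delta (R : standard Delta -> Prop)
    (x : env (var Gamma) Delta) (e : env E Gamma) :
  rel_ext (fun d : standard Gamma => R (subst d x)) e <->
  rel_ext R (subst e x).
Proof. exact: (@rel_ext_definable _ _ (FRel R x)). Qed.

Lemma rel_ext_not Gamma (R : standard Gamma -> Prop) (e : env E Gamma) :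
  rel_ext (fun d => ~ R d) e <-> ~ rel_ext R e.
Proof.
rewrite (@rel_ext_definable _ _ (FNot (FRel R (vars Gamma)))).
  by rewrite /= -/(subst e (vars Gamma)) subst_vars.
by move=> d; rewrite /= -/(subst d (vars Gamma)) subst_vars.
Qed.

Lemma rel_ext_and Gamma (R R' : standard Gamma -> Prop) (e : env E Gamma) :
  rel_ext (fun d => R d /\ R' d) e <-> rel_ext R e /\ rel_ext R' e.
Proof.
rewrite (@rel_ext_definable _ _
  (FAnd (FRel R (vars Gamma)) (FRel R' (vars Gamma)))).
  by rewrite /= -/(subst e (vars Gamma)) subst_vars.
by move=> d; rewrite /= -/(subst d (vars Gamma)) subst_vars.
Qed.

Lemma rel_ext_sub Gamma (R R' : standard Gamma -> Prop) (e : env E Gamma) :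
  (forall d, R d -> R' d) -> rel_ext R e -> rel_ext R' e.
Proof.
move=> RR'; have -> : R = (fun d => R d /\ R' d).
  apply/funext => d; apply/propext.
  by split=> [Rd|[]//]; split=> //; exact: RR'.
by move=> /rel_ext_and[].
Qed.

(** Since atomic formulas have no nested terms, the composite relation is defined by: for all [y],
    if [f] takes the value [y], then [R] holds of [y]. *)
Lemma rel_ext_fun Gamma Delta Y (R : standard (Y :: Gamma) -> Prop)
    (f : standard Delta -> Y) (x : env (var Gamma) Delta) (e : env E Gamma) :
  rel_ext (fun d : standard Gamma => R (f (subst d x), d)) e <->
  @rel_ext E (Y :: Gamma) R (fun_ext f (subst e x), e).
Proof.
have satE (M : interpretation) (d : env M Gamma) :
    sat (FForall (FImp (FFun f (weaken Y x) (VZ Gamma Y))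
                       (FRel R (vars (Y :: Gamma))))) d <->
    @rel_ext M (Y :: Gamma) R (fun_ext f (subst d x), d).
  have impE y : sat (FImp (FFun f (weaken Y x) (VZ Gamma Y))
                       (FRel R (vars (Y :: Gamma)))) (y, d) <->
      (fun_ext f (subst d x) = y -> @rel_ext M (Y :: Gamma) R (y, d)).
    rewrite sat_imp -[X in _ -> rel_ext _ X](@subst_vars M (Y :: Gamma)).
    by rewrite -(subst_weaken y d x).
  split=> [h|h y]; first exact/(impE (fun_ext f (subst d x))).1.
  by apply/impE => <-.
by rewrite -satE; apply: rel_ext_definable => d; rewrite satE.
Qed.

Lemma fun_ext_const (X : Type) (c : X) :
  @fun_ext E [::] X (fun=> c) tt = std E c.
Proof.
by apply: (transfer E (@FFun [:: X] [::] X (fun=> c) tt (VZ _ _)) (c, tt)).1.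
Qed.

Lemma rel_ext_std Gamma Y (R : standard (Y :: Gamma) -> Prop) (c : Y)
    (e : env E Gamma) :
  rel_ext (fun d : standard Gamma => R (c, d)) e <->
  @rel_ext E (Y :: Gamma) R (std E c, e).
Proof. by rewrite -fun_ext_const -(@rel_ext_fun _ [::] Y R _ tt). Qed.

(** * Extensions of sets *)

Lemma starset_std (T : Type) (B : set T) (x : T) :
  starset E B (std E x) <-> B x.
Proof.
by have /= := transfer E (@FRel [:: T] [:: T] (fun e => B e.1) (VZ _ _, tt))
  (x, tt); split=> /H.
Qed.

Lemma starset_sub (T : Type) (B C : set T) :
  B `<=` C -> starset E B `<=` starset E C.
Proof. by move=> BC x; apply: rel_ext_sub => -[y []] /BC. Qed.

Lemma starsetC (T : Type) (B : set T) : starset E (~` B) = ~` starset E B.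
Proof. by apply/funext => x; apply/propext; exact: rel_ext_not. Qed.

Lemma starsetI (T : Type) (B C : set T) :
  starset E (B `&` C) = starset E B `&` starset E C.
Proof. by apply/funext => x; apply/propext; exact: rel_ext_and. Qed.

Lemma starset0 (T : Type) : starset E (@set0 T) = set0.
Proof.
by rewrite -(setICr (@set0 T)) starsetI starsetC setICr.
Qed.

Lemma starsetT (T : Type) : starset E [set: T] = setT.
Proof. by rewrite -setC0 starsetC starset0 setC0. Qed.

Lemma starset_bigcap (I T : Type) (J : set I) (B : I -> set T) :
  finite_set J ->
  starset E (\bigcap_(i in J) B i) = \bigcap_(i in J) starset E (B i).
Proof.
elim/finite_set_induction => [|i {}J _ IHJ].
  by rewrite !bigcap_set0 starsetT.
by rewrite !bigcap_setU1 starsetI IHJ.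
Qed.

Lemma starset_bigcup (I T : Type) (J : set I) (B : I -> set T) :
  finite_set J ->
  starset E (\bigcup_(i in J) B i) = \bigcup_(i in J) starset E (B i).
Proof.
move=> fJ; rewrite -[LHS]setCK -starsetC setC_bigcup starset_bigcap //.
by rewrite setC_bigcap; apply: eq_bigcupr => i _; rewrite starsetC setCK.
Qed.

(** This is how a nonstandard witness yields a standard one. *)
Lemma starset_nonempty (T : Type) (B : set T) :
  starset E B !=set0 -> B !=set0.
Proof.
move=> [x Bx]; apply/set0P/eqP => B0.
by move: Bx; rewrite B0 starset0.
Qed.

Lemma internal_set_std (T : Type) (B : set T) :
  internal_set (std E B) = starset E B.
Proof.
apply/funext => x; apply/propext.
have := @rel_ext_std [:: T] (set T) (fun e => e.1 e.2.1) B (x, tt).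
have := @rel_ext_subst [:: set T; T] [:: T; set T] (fun e => e.2.1 e.1)
  (VS _ (VZ _ _), (VZ _ _, tt)) (std E B, (x, tt)).
by move=> h1 h2; exact: iff_trans (iff_sym h1) (iff_sym h2).
Qed.

(** * Saturation and hyperfinite sets *)

Lemma saturated_inj (K K' : Type) (f : K' -> K) :
  injective f -> saturated E K -> saturated E K'.
Proof.
move=> injf satK T b finb.
(* Outside the range of [f] the family is the whole space, which imposes no condition. *)
pose b' k :=
  if pselect (exists k', f k' = k) is left ex
  then b (projT1 (cid ex)) else std E [set: T].
have b'f k' : b' (f k') = b k'.
  rewrite /b'; case: pselect => [ex|[]]; last by exists k'.
  by congr b; apply: injf; exact: (projT2 (cid ex)).
have [|xi b'xi] := satK T b'; last first.
  by exists xi => k' _; rewrite -b'f; exact: b'xi.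
move=> J fJ; have [|xi bxi] := finb (f @^-1` J).
  by apply: finite_preimage => // ? ? _ _; exact: injf.
exists xi => k Jk; rewrite /b'; case: pselect => [ex|_].
  by apply: bxi; rewrite /= (projT2 (cid ex)).
by rewrite internal_set_std starsetT.
Qed.

Definition hyper_mem (T : Type) (X : set T) (h : E (Pfin X)) : set (E T) :=
  [set xi | @rel_ext E [:: T; Pfin X] (fun e => (e.2.1 : set T) e.1)
              (xi, (h, tt))].

Lemma hyper_mem_std (T : Type) (X : set T) (h : E (Pfin X)) (x : T) :
  hyper_mem h (std E x) <-> starset E [set F : Pfin X | (F : set T) x] h.
Proof.
by rewrite /starset /= (@rel_ext_std [:: Pfin X] T
  (fun e => (e.2.1 : set T) e.1)).
Qed.

Lemma saturated_hyperfinite_cover (T : Type) (X : set T) :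
  saturated E T -> exists h : E (Pfin X), std E @` X `<=` hyper_mem h.
Proof.
move=> satT.
have [|h hX] := satT (Pfin X)
  (* The family is indexed by all of [T]; the premise [X x] makes the indices outside [X]
     harmless. *)
  (fun x => std E [set F : Pfin X | X x -> (F : set T) x]).
  move=> J fJ; exists (std E (Pfin_cover X fJ)) => x Jx.
  by rewrite internal_set_std starset_std.
exists h => _ [x Xx <-]; apply/hyper_mem_std.
by have := hX x I; rewrite internal_set_std; apply: starset_sub => F /(_ Xx).
Qed.

Lemma hyperfinite_approximation_exists (T : Type) :
  saturated E T ->
  exists H : set (E T), hyperfinite_approximation [set: T] H.
Proof.
move=> /(saturated_hyperfinite_cover [set: T])[h hT].
by exists (hyper_mem h); split=> //; [exists h | rewrite starsetT].
Qed.

(** As [F] is finite, its supersets form a finite intersection of standard sets, and [h] lies in the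
    extension of each. *)
Lemma starset_supersets (T : Type) (X : set T) (h : E (Pfin X)) (F : Pfin X) :
  std E @` X `<=` hyper_mem h -> starset E [set F' : Pfin X | F `<=` F'] h.
Proof.
move=> hX.
have -> : [set F' : Pfin X | F `<=` F'] =
    \bigcap_(x in F) [set F' : Pfin X | (F' : set T) x] by [].
rewrite starset_bigcap; last exact: Pfin_finite.
by move=> x Fx; apply/hyper_mem_std/hX; exists x => //; exact: Pfin_sub Fx.
Qed.

(** * Translates *)

Section Translates.
Variable S : semigroupType.

Lemma starset_mul (B : set S) (xi eta : E S) :
  starset E B (starmul xi eta) <->
  @rel_ext E [:: S : Type; S : Type] (fun e => B (e.1 * e.2.1)%g)
    (xi, (eta, tt)).
Proof.
rewrite (@rel_ext_fun [:: S : Type; S : Type] [:: S : Type; S : Type] S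
  (fun e => B e.1) (fun e => (e.1 * e.2.1)%g) (vars [:: S : Type; S : Type])).
by rewrite (@rel_ext_subst [:: S : Type; S : Type; S : Type] [:: S : Type]
  (fun e => B e.1) (VZ _ _, tt)).
Qed.

Lemma starset_std_mul (B : set S) (g : S) (xi : E S) :
  starset E B (starmul (std E g) xi) <-> starset E [set x | B (g * x)%g] xi.
Proof.
by rewrite starset_mul -(@rel_ext_std [:: S : Type] S
  (fun e => B (e.1 * e.2.1)%g)).
Qed.

(** A finite [G] makes the translate a finite union, with which the extension commutes. *)
Lemma starset_inv_translate (G B : set S) : finite_set G ->
  starset E (inv_translate G B) = star_inv_translate E G B.
Proof.
move=> fG.
have -> : inv_translate G B = \bigcup_(g in G) [set x | B (g * x)%g] by [].
rewrite starset_bigcup //; apply/seteqP; split=> xi [g Gg Bg]; exists g => //.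
- exact/starset_std_mul.
- exact/starset_std_mul.
Qed.

(** If no finite [G] works, the internal sets of those [xi] in [h] with [g * (xi * alpha)] outside
    the extension of [B] have the finite intersection property. A point common to all [g]
    contradicts the hypothesis. *)
Lemma star_inv_translate_saturation (h : E (Pfin [set: S])) (alpha : E S)
    (B : set S) : saturated E S ->
  rtranslate (hyper_mem h) alpha `<=` star_inv_translate E [set: S] B ->
  exists G : Pfin [set: S],
    rtranslate (hyper_mem h) alpha `<=` star_inv_translate E G B.
Proof.
move=> satS hB.
pose c g (e : standard [:: Pfin [set: S]; S : Type]) : set S :=
  [set x | (e.1 : set S) x /\ ~ B (g * (x * e.2.1))%g].
pose b g := @fun_ext E [:: Pfin [set: S]; S : Type] (set S) (c g)
  (h, (alpha, tt)).
have bE g xi : internal_set (b g) xi <->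
    hyper_mem h xi /\ ~ starset E B (starmul (std E g) (starmul xi alpha)).
  pose Gamma := [:: S : Type; Pfin [set: S]; S : Type].
  have mem_c := @rel_ext_fun Gamma [:: Pfin [set: S]; S : Type] (set S)
    (fun e => e.1 e.2.1) (c g) (VS _ (VZ _ _), (VS _ (VS _ (VZ _ _)), tt))
    (xi, (h, (alpha, tt))).
  have mem_b := @rel_ext_subst (set S :: Gamma) [:: S : Type; set S]
    (fun e => e.2.1 e.1) (VS _ (VZ _ _), (VZ _ _, tt))
    (b g, (xi, (h, (alpha, tt)))).
  have mem_h := @rel_ext_subst Gamma [:: S : Type; Pfin [set: S]]
    (fun e => (e.2.1 : set S) e.1) (VZ _ _, (VS _ (VZ _ _), tt))
    (xi, (h, (alpha, tt))).
  have mem_B := @rel_ext_subst Gamma [:: S : Type; S : Type]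
    (fun e => B (g * (e.1 * e.2.1))%g) (VZ _ _, (VS _ (VS _ (VZ _ _)), tt))
    (xi, (h, (alpha, tt))).
  apply: (iff_trans (iff_sym mem_b)); apply: (iff_trans (iff_sym mem_c)).
  apply: (iff_trans (rel_ext_and _ _ _)); rewrite rel_ext_not.
  by rewrite starset_std_mul starset_mul; split=> -[/mem_h ? /mem_B].
apply: contrapT => noG.
have [|xi bxi] := satS S b; last first.
  (* Some index is needed to read off that [xi] lies in [h]; the existence of [alpha] provides
     one. *)
  have [g0 _] : [set: S] !=set0.
    by apply: starset_nonempty; exists alpha; rewrite starsetT.
  have [|g _ Bg] := hB (starmul xi alpha).
    by exists xi => //; have /bE[] := bxi g0 I.
  by have /bE[_] := bxi g I.
move=> J fJ; have /existsNP[_ /not_implyP[[xi hxi <-] nxi]] :=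
  (forallNP _).2 noG (Pfin_cover setT fJ).
by exists xi => g Jg; apply/bE; split=> // Bg; apply: nxi; exists g.
Qed.

(** The standard [G] is kept, and [alpha] depends on [h] and a hyperfinite cover of [A], but not on
    [F]. *)
Lemma syndetic_hyperfinite (A : set (set S)) (h : E (Pfin [set: S])) :
  saturated E (set S) -> collectionwise_piecewise_syndetic A ->
  exists (alpha : E S) (G : Pfin A -> Pfin [set: S]), forall F : Pfin A,
    rtranslate (hyper_mem h) alpha `<=`
      star_inv_translate E (G F) (\bigcap_(B in F) B).
Proof.
move=> satE [G [chi chiP]].
have [hA hAP] := saturated_hyperfinite_cover A satE.
exists (@fun_ext E [:: Pfin A; Pfin [set: S]] S (fun e => chi e.1 e.2.1)
  (hA, (h, tt))), G => F _ [xi hxi <-].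
rewrite -starset_inv_translate; last exact: Pfin_finite.
set P := inv_translate _ _; apply/starset_mul.
pose Gamma := [:: S : Type; Pfin A; Pfin [set: S]].
pose e : env E Gamma := (xi, (hA, (h, tt))).
apply/(@rel_ext_subst ((S : Type) :: Gamma) [:: S : Type; S : Type]
  (fun e => P (e.1 * e.2.1)%g) (VS _ (VZ _ _), (VZ _ _, tt)) (_, e)).
apply/(@rel_ext_fun Gamma [:: Pfin A; Pfin [set: S]] S
  (fun e => P (e.2.1 * e.1)%g) (fun e => chi e.1 e.2.1)
  (VS _ (VZ _ _), (VS _ (VS _ (VZ _ _)), tt)) e).
(* The syndeticity condition for fixed [F] is now an inclusion of standard relations in [x], [HH]
   and [F0]; its premises remain to be checked at [xi], [hA] and [h]. *)
apply: (@rel_ext_sub Gamma (fun e => F `<=` e.2.1 /\ (e.2.2.1 : set S) e.1)).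
  by move=> [x [HH [F0 []]]] /= [FHH F0x]; apply: (chiP F0 F HH FHH); exists x.
apply/rel_ext_and; split.
  apply/(@rel_ext_subst Gamma [:: Pfin A] (fun e => F `<=` e.1)
    (VS _ (VZ _ _), tt)).
  exact: starset_supersets.
by apply/(@rel_ext_subst Gamma [:: S : Type; Pfin [set: S]]
  (fun e => (e.2.1 : set S) e.1) (VZ _ _, (VS _ (VS _ (VZ _ _)), tt))).
Qed.

Lemma syndetic_of_translate (A : set (set S)) (alpha : E S)
    (G : Pfin A -> Pfin [set: S]) :
  (forall F : Pfin A, rtranslate (std E @` [set: S]) alpha `<=`
     star_inv_translate E (G F) (\bigcap_(B in F) B)) ->
  collectionwise_piecewise_syndetic A.
Proof.
move=> alphaG; pose P (F : Pfin A) := inv_translate (G F) (\bigcap_(B in F) B).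
have [|chi chiP] := @choice (Pfin A * Pfin [set: S])%type S (fun p a =>
    forall F : Pfin A, F `<=` p.1 ->
    forall x, (p.2 : set S) x -> P F (x * a)%g).
  (* The admissible values of [chi] at [p] form a finite intersection, because [p.1] has finitely
     many subsets and [p.2] is finite. *)
  move=> p; have [|a aP] := @starset_nonempty S
    (\bigcap_(F in [set F : Pfin A | F `<=` p.1])
    \bigcap_(x in p.2) [set a | P F (x * a)%g]); last first.
    by exists a => F FHH x; exact: aP.
  exists alpha; rewrite starset_bigcap; last first.
    exact/finite_Pfin_subsets/Pfin_finite.
  move=> F FHH; rewrite starset_bigcap; last exact: Pfin_finite.
  move=> x _; apply/starset_std_mul; rewrite starset_inv_translate.
    by apply: alphaG; exists (std E x) => //; exists x.
  exact: Pfin_finite.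
exists G, (fun HH F => chi (HH, F)) => F FF HH FFHH _ [x Fx <-].
exact: chiP (HH, F) _ FFHH _ Fx.
Qed.

End Translates.
End Extension.

Unset Implicit Arguments.
Set Strict Implicit.

Theorem theorem4p2p2 (S : semigroupType) (A : set (set S))
    (E : nonstandard_extension) (saturatedE : saturated E (set S)) :
  [<-> collectionwise_piecewise_syndetic A;
       forall H : set (E S), hyperfinite_approximation [set: S] H ->
         exists alpha : E S, forall F : Pfin A,
           rtranslate H alpha `<=`
             star_inv_translate E [set: S] (\bigcap_(B in F) B);
       forall H : set (E S), hyperfinite_approximation [set: S] H ->
         exists (alpha : E S) (G : Pfin A -> Pfin [set: S]),
           forall F : Pfin A,
             rtranslate H alpha `<=`
               star_inv_translate E (G F) (\bigcap_(B in F) B);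
       exists (H : set (E S)) (alpha : E S) (G : Pfin A -> Pfin [set: S]),
         hyperfinite_approximation [set: S] H /\
         forall F : Pfin A,
           rtranslate H alpha `<=`
             star_inv_translate E (G F) (\bigcap_(B in F) B);
       exists (alpha : E S) (G : Pfin A -> Pfin [set: S]),
         forall F : Pfin A,
           rtranslate (std E @` [set: S]) alpha `<=`
             star_inv_translate E (G F) (\bigcap_(B in F) B)].
Proof.
(* Singletons embed [S] into [set S], so saturation passes down to [S]. *)
have satS : saturated E S.
  apply: (@saturated_inj E _ _ set1 _ saturatedE) => x y xy.
  by have : [set y] x by rewrite -xy.
tfae.
- move=> synA _ [[h ->] _ _].
  have [alpha [G alphaG]] := syndetic_hyperfinite h saturatedE synA.
  by exists alpha => F xi /(alphaG F)[g _ Bg]; exists g.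
- move=> hyp H apH; have [alpha alphaP] := hyp H apH.
  (* Saturation gives a finite set for each [F] separately, with the same [alpha]; choice assembles
     them into [G]. *)
  case: apH alphaP => -[h ->] _ _ alphaP.
  have [G alphaG] :=
    choice (fun F => star_inv_translate_saturation satS (alphaP F)).
  by exists alpha, G.
- move=> hyp; have [H apH] := hyperfinite_approximation_exists satS.
  by have [alpha [G alphaG]] := hyp H apH; exists H, alpha, G.
- move=> [H [alpha [G [[_ SH _] alphaG]]]]; exists alpha, G => F.
  by move=> _ [xi Sxi <-]; apply: alphaG; exists xi => //; exact: SH.
- by move=> [alpha [G]]; exact: syndetic_of_translate.
Qed.
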